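(* In the setting of the context, suppose Property (P) holds with radius $R>0$ and functions $q_1,q_2,q_3$ (with constants $C_1,C_2,C_3$). Let $t<T$ and suppose the current state $x_t$ of $\mathrm{MPC}_k$ satisfies $x_t\in\mathcal{B}(x_t^*,R/C_3)$, and, for $t<T-k$, that the terminal cost $F_{t+k}$ of $\mathrm{MPC}_k$ is set to be the indicator function of some state $\bar y(\xi_{t+k\mid t})$ (i.e. the terminal cost used at time $t$ is $\mathbb{I}(\cdot;\bar y(\xi_{t+k\mid t}))$) satisfying $\bar y(\xi_{t+k\mid t})\in\mathcal{B}(x_{t+k}^*,R)$. Then the per-step error of $\mathrm{MPC}_k$ satisfies $$e_t\le\sum_{\tau=0}^{k}\left(\left(\frac{R}{C_3}+D_{x^*}\right)q_1(\tau)+q_2(\tau)\right)\rho_{t,\tau}+2R\left(\left(\frac{R}{C_3}+D_{x^*}\right)q_1(k)+q_2(k)\right).$$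
   Context: Notation: $\|\cdot\|$ is the Euclidean norm, $\mathcal{B}(x,r)$ the closed ball of radius $r$ around $x$, and $\alpha_{t_1:t_2}=(\alpha_{t_1},\dots,\alpha_{t_2})$. Online control problem. States $x_t\in\mathbb{R}^n$, actions $u_t\in\mathbb{R}^m$, horizon $T$. Stage costs $f_t(x,u;\xi_t)$, dynamics $g_t(x,u;\xi_t)$, constraint functions $s_t(x,u;\xi_t)$ for $0\le t<T$ and terminal cost $F_T(x;\xi_T)$ are function families parameterized by $\xi_t\in\Xi_t$, where $\Xi_t$ has diameter at most $1$. The true parameters are $\xi_t^*\in\Xi_t$. The problem is to minimize $\sum_{t=0}^{T-1}f_t(x_t,u_t;\xi_t^* )+F_T(x_T;\xi_T^* )$ over $x_{0:T},u_{0:T-1}$ subject to $x_{t+1}=g_t(x_t,u_t;\xi_t^* )$, $s_t(x_t,u_t;\xi_t^* )\le 0$ for $0\le t<T$, and $x_0=x(0)$. Its optimal trajectory (with full knowledge of $\xi^*_{0:T}$) is $\mathrm{OPT}$, with states $x_t^*$ and actions $u_t^*$. Standing assumptions: (i) $\|x_t^*\|\le D_{x^*}$ for all $t$; (ii) $\|g_t(x,u;\xi_t^* )-g_t(x,u';\xi_t^* )\|\le L_g\|u-u'\|$ for all feasible $x,u,u'$; (iii) $f_t(\cdot,\cdot;\xi_t^* )$ and $F_T(\cdot;\xi_T^* )$ are nonnegative, convex and $\ell$-smooth. Predictions. With prediction horizon $k$ ($1\le k\le T$), at time $t$ the controller receives $\xi_{\tau\mid t}\in\Xi_\tau$ for $t\le\tau\le\min\{t+k,T\}$.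 Prediction error: $\rho_{t,\tau}=\|\xi_{t+\tau\mid t}-\xi_{t+\tau}^*\|$, with $\rho_{t,\tau}=0$ if $t+\tau>T$. FTOCP. For $t_1<t_2$, initial state $z$, parameters $\xi_{t_1:t_2-1}$, terminal parameter $\zeta_{t_2}$ (also written $\xi_{t_2}$, not necessarily in $\Xi_{t_2}$) and terminal cost $F$ (possibly $+\infty$-valued), $\psi_{t_1}^{t_2}(z,\xi_{t_1:t_2-1},\zeta_{t_2};F)$ denotes an optimal solution of: minimize $\sum_{t=t_1}^{t_2-1}f_t(y_t,v_t;\xi_t)+F(y_{t_2};\zeta_{t_2})$ over $y_{t_1:t_2},v_{t_1:t_2-1}$ subject to $y_{t+1}=g_t(y_t,v_t;\xi_t)$, $s_t(y_t,v_t;\xi_t)\le0$ for $t_1\le t<t_2$, $y_{t_1}=z$. Subscripts $y_t$, $v_t$ select entries of the solution. $\mathbb{I}$ is the indicator terminal cost: $\mathbb{I}(y;\zeta)=0$ if $y=\zeta$, $+\infty$ otherwise ($\zeta\in\mathbb{R}^n$). $\mathrm{MPC}_k$: at each time $t$, with $t'=\min\{t+k,T\}$, it observes $x_t$ and $\xi_{t:t'\mid t}$ and applies $u_t=\psi_t^{t'}(x_t,\xi_{t:t'\mid t};F_{t'})_{v_t}$, where $F_{t'}$ for $t'<T$ is a specified terminal cost and $F_T$ is the true terminal cost family; then $x_{t+1}=g_t(x_t,u_t;\xi_t^* )$. Per-step error: $e_t=\|u_t-\psi_t^T(x_t,\xi_{t:T}^*;F_T)_{v_t}\|$. Property (P),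 with radius $R>0$ and nonnegative functions $q_1,q_2,q_3$ on $\{0,1,2,\dots\}$ such that $\lim_{t\to\infty}q_i(t)=0$ for $i=1,2$ and $\sum_{t=0}^\infty q_i(t)\le C_i$, $C_i\ge1$, $i=1,2,3$, means: (a) The bound $$\|\psi_{t_1}^{t_2}(z,\xi_{t_1:t_2};F)_{v_{t_1}}-\psi_{t_1}^{t_2}(z,\xi'_{t_1:t_2};F)_{v_{t_1}}\|\le\Big(\sum_{t=t_1}^{t_2}q_1(t-t_1)\delta_t\Big)\|z\|+\sum_{t=t_1}^{t_2}q_2(t-t_1)\delta_t,\quad \delta_t=\|\xi_t-\xi'_t\|,$$ holds: for $t_1=t$, $t_2=t+k$, $t<T-k$, with $F=\mathbb{I}$, $z\in\mathcal{B}(x_t^*,R)$, $\xi_{t:t+k-1}\in\Xi_t\times\cdots\times\Xi_{t+k-1}$, $\xi'_{t:t+k-1}=\xi^*_{t:t+k-1}$, and $\xi_{t+k},\xi'_{t+k}\in\mathcal{B}(x_{t+k}^*,R)\subseteq\mathbb{R}^n$; and for $t_1=t$, $t_2=T$, $t\ge T-k$, with $F=F_T$, $z\in\mathcal{B}(x_t^*,R)$, $\xi_{t:T}\in\Xi_t\times\cdots\times\Xi_T$, $\xi'_{t:T}=\xi^*_{t:T}$. (b) For every $t_1<T$, $t_2=T$, $F=F_T$, all $z,z'\in\mathcal{B}(x_{t_1}^*,R)$, and all $t\in[t_1,T]$, $$\|\psi_{t_1}^{T}(z,\xi^*_{t_1:T};F_T)_{y_t/v_t}-\psi_{t_1}^{T}(z',\xi^*_{t_1:T};F_T)_{y_t/v_t}\|\le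 q_3(t-t_1)\|z-z'\|,$$ where $y_t/v_t$ means the bound holds for both the $y_t$ entry and (for $t<T$) the $v_t$ entry. *)

(* Defs.v *)
From mathcomp Require Import all_boot all_order all_algebra.
From mathcomp Require Import all_classical all_reals all_analysis.
Set Implicit Arguments.
Unset Strict Implicit.
Unset Printing Implicit Defensive.
Import Order.TTheory GRing.Theory Num.Theory.
Import numFieldNormedType.Exports.
Local Open Scope classical_set_scope.
Local Open Scope ring_scope.

(* The canonical norm of 'rV[R]_d in the library is the max norm, hence these
   Euclidean counterparts. *)
Definition enorm (R : realType) (d : nat) (x : 'rV[R]_d) : R :=
  Num.sqrt (\sum_(i < d) x 0 i ^+ 2).

Definition eball (R : realType) (d : nat) (x : 'rV[R]_d) (r : R) : set 'rV[R]_d :=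
  [set y | enorm (y - x) <= r].

Definition gradient (R : realType) (d : nat) (h : 'rV[R]_d -> R) (w : 'rV[R]_d) :
  'rV[R]_d := \row_(i < d) 'D_(delta_mx 0 i) h w.

Definition smooth (R : realType) (d : nat) (l : R) (h : 'rV[R]_d -> R) : Prop :=
  (forall w, differentiable h w) /\
  forall w w', enorm (gradient h w - gradient h w') <= l * enorm (w - w').

(* The time-t parameter lives in R^(p t) and the time-t constraint function
   takes values in R^(c t), its sign condition being componentwise. Only the
   times t < horizon (t <= horizon for the parameters) are meaningful. *)
Record control_problem (R : realType) (n m : nat) (p c : nat -> nat) :=
  ControlProblem {
    horizon : nat;
    stage_cost : forall t, 'rV[R]_n -> 'rV[R]_m -> 'rV[R]_(p t) -> R;
    dynamics : forall t, 'rV[R]_n -> 'rV[R]_m -> 'rV[R]_(p t) -> 'rV[R]_n;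
    constraint : forall t, 'rV[R]_n -> 'rV[R]_m -> 'rV[R]_(p t) -> 'rV[R]_(c t);
    terminal_cost : 'rV[R]_n -> 'rV[R]_(p horizon) -> R;
    param_set : forall t, set 'rV[R]_(p t);
    true_param : forall t, 'rV[R]_(p t);
    init_state : 'rV[R]_n
  }.

Arguments stage_cost {R n m p c} P t x u xi : rename.
Arguments dynamics {R n m p c} P t x u xi : rename.
Arguments constraint {R n m p c} P t x u xi : rename.
Arguments terminal_cost {R n m p c} P x xi : rename.
Arguments param_set {R n m p c} P t : rename.
Arguments true_param {R n m p c} P t : rename.

Section ControlProblem.
Variables (R : realType) (n m : nat) (p c : nat -> nat).
Variable P : control_problem R n m p c.
Local Notation T := (horizon P).
Local Notation params := (forall t, 'rV[R]_(p t)).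
Local Notation states := (nat -> 'rV[R]_n).
Local Notation actions := (nat -> 'rV[R]_m).

Definition admissible_params : Prop :=
  forall t, (t <= T)%N ->
    param_set P t (true_param P t) /\
    forall a b, param_set P t a -> param_set P t b -> enorm (a - b) <= 1.

Definition constraint_sat (t : nat) (x : 'rV[R]_n) (u : 'rV[R]_m) (xi : 'rV[R]_(p t)) : Prop :=
  forall i, constraint P t x u xi 0 i <= 0.

Arguments constraint_sat : clear implicits.

Definition final_cost (y : 'rV[R]_n) (zeta : 'rV[R]_(p T)) : \bar R :=
  (terminal_cost P y zeta)%:E.

Definition indicator_cost (y zeta : 'rV[R]_n) : \bar R :=
  (if y == zeta then 0 else +oo)%E.

Definition ftocp_feasible (t1 t2 : nat) (z : 'rV[R]_n) (xi : params)
    (y : states) (v : actions) : Prop :=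
  y t1 = z /\
  forall t, (t1 <= t < t2)%N ->
    y t.+1 = dynamics P t (y t) (v t) (xi t) /\ constraint_sat t (y t) (v t) (xi t).

Definition ftocp_cost (d t1 t2 : nat) (xi : params) (zeta : 'rV[R]_d)
    (F : 'rV[R]_n -> 'rV[R]_d -> \bar R) (y : states) (v : actions) : \bar R :=
  ((\sum_(t1 <= t < t2) stage_cost P t (y t) (v t) (xi t))%:E + F (y t2) zeta)%E.

(* (y, v) is a value of psi_{t1}^{t2}(z, xi, zeta; F): a trajectory of finite
   cost that minimizes the cost among the feasible ones. Trajectories are
   sequences over nat, whose entries outside the window are irrelevant.
   Uniqueness is not assumed, so psi is this relation, not a function; an
   infeasible problem (in particular an indicator terminal cost at an
   unreachable state) has no solution. *)
Definition ftocp_solution (d t1 t2 : nat) (z : 'rV[R]_n) (xi : params)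
    (zeta : 'rV[R]_d) (F : 'rV[R]_n -> 'rV[R]_d -> \bar R)
    (y : states) (v : actions) : Prop :=
  [/\ ftocp_feasible t1 t2 z xi y v,
      (ftocp_cost t1 t2 xi zeta F y v < +oo)%E &
      forall y' v', ftocp_feasible t1 t2 z xi y' v' ->
        (ftocp_cost t1 t2 xi zeta F y v <= ftocp_cost t1 t2 xi zeta F y' v')%E].

Definition clairvoyant_solution (t : nat) (z : 'rV[R]_n) (y : states) (v : actions) :
    Prop :=
  ftocp_solution t T z (true_param P) (true_param P T) final_cost y v.

Definition optimal_trajectory (xs : states) (us : actions) : Prop :=
  clairvoyant_solution 0 (init_state P) xs us.

Record standing_assumptions (xs : states) (D Lg l : R) : Prop :=
  StandingAssumptions {
    opt_bounded : forall t, (t <= T)%N -> enorm (xs t) <= D;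
    dynamics_lipschitz : forall t, (t < T)%N -> forall x u u',
      constraint_sat t x u (true_param P t) ->
      constraint_sat t x u' (true_param P t) ->
      enorm (dynamics P t x u (true_param P t) - dynamics P t x u' (true_param P t))
        <= Lg * enorm (u - u');
    stage_cost_regular : forall t, (t < T)%N ->
      let h (w : 'rV[R]_(n + m)) :=
        stage_cost P t (lsubmx w) (rsubmx w) (true_param P t) in
      [/\ forall w, 0 <= h w, convex_function [set: 'rV[R]_(n + m)] h & smooth l h];
    terminal_cost_regular :
      let h (x : 'rV[R]_n) := terminal_cost P x (true_param P T) in
      [/\ forall x, 0 <= h x, convex_function [set: 'rV[R]_n] h & smooth l h]
  }.

(* xip t tau is the prediction of the time-tau parameter received at time t. *)
Definition admissible_predictions (k : nat) (xip : nat -> params) : Prop :=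
  forall t tau, (t < T)%N -> (t <= tau <= minn (t + k) T)%N ->
    param_set P tau (xip t tau).

Definition prediction_error (xip : nat -> params) (t tau : nat) : R :=
  if (t + tau <= T)%N then enorm (xip t (t + tau)%N - true_param P (t + tau)) else 0.

Definition perturbation_bound (q1 q2 : nat -> R) (d t1 t2 : nat) (z : 'rV[R]_n)
    (xi xi' : params) (zeta zeta' : 'rV[R]_d)
    (F : 'rV[R]_n -> 'rV[R]_d -> \bar R) : Prop :=
  let delta t :=
    if (t < t2)%N then enorm (xi t - xi' t) else enorm (zeta - zeta') in
  forall y v y' v',
    ftocp_solution t1 t2 z xi zeta F y v ->
    ftocp_solution t1 t2 z xi' zeta' F y' v' ->
    enorm (v t1 - v' t1) <=
      (\sum_(t1 <= t < t2.+1) q1 (t - t1)%N * delta t) * enorm z +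
      \sum_(t1 <= t < t2.+1) q2 (t - t1)%N * delta t.

Record property_P (k : nat) (xs : states) (r : R)
    (q1 q2 q3 : nat -> R) (C1 C2 C3 : R) : Prop := PropertyP {
  radius_gt0 : 0 < r;
  q_ge0 : forall t, [/\ 0 <= q1 t, 0 <= q2 t & 0 <= q3 t];
  q1_cvg0 : q1 t @[t --> \oo] --> 0;
  q2_cvg0 : q2 t @[t --> \oo] --> 0;
  C_ge1 : [/\ 1 <= C1, 1 <= C2 & 1 <= C3];
  q1_sum : (\sum_(0 <= t <oo) (q1 t)%:E <= C1%:E)%E;
  q2_sum : (\sum_(0 <= t <oo) (q2 t)%:E <= C2%:E)%E;
  q3_sum : (\sum_(0 <= t <oo) (q3 t)%:E <= C3%:E)%E;
  perturbation_indicator : forall t, (t < T - k)%N ->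
    forall z xi zeta zeta',
      eball (xs t) r z ->
      (forall tau, (t <= tau < t + k)%N -> param_set P tau (xi tau)) ->
      eball (xs (t + k)%N) r zeta ->
      eball (xs (t + k)%N) r zeta' ->
      perturbation_bound q1 q2 t (t + k) z xi (true_param P) zeta zeta'
        indicator_cost;
  perturbation_final : forall t, (T - k <= t < T)%N ->
    forall z xi,
      eball (xs t) r z ->
      (forall tau, (t <= tau <= T)%N -> param_set P tau (xi tau)) ->
      perturbation_bound q1 q2 t T z xi (true_param P) (xi T) (true_param P T)
        final_cost;
  perturbation_state : forall t1, (t1 < T)%N ->
    forall z z', eball (xs t1) r z -> eball (xs t1) r z' ->
    forall y v y' v',
      clairvoyant_solution t1 z y v ->
      clairvoyant_solution t1 z' y' v' ->
      (forall t, (t1 <= t <= T)%N ->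
        enorm (y t - y' t) <= q3 (t - t1)%N * enorm (z - z')) /\
      (forall t, (t1 <= t < T)%N ->
        enorm (v t - v' t) <= q3 (t - t1)%N * enorm (z - z'))
}.

Definition mpc_action (k : nat) (F : forall t, 'rV[R]_n -> 'rV[R]_(p t) -> \bar R)
    (xip : nat -> params) (t : nat) (x : 'rV[R]_n) (u : 'rV[R]_m) : Prop :=
  let t' := minn (t + k) T in
  exists y v, ftocp_solution t t' x (xip t) (xip t t') (F t') y v /\ u = v t.

(* The states x_0, ..., x_t and the actions u_0, ..., u_t are produced by the
   controller; nothing is required of it after time t. *)
Record mpc_trajectory (k : nat) (F : forall t, 'rV[R]_n -> 'rV[R]_(p t) -> \bar R)
    (xip : nat -> params) (t : nat) (x : states) (u : actions) : Prop :=
  MpcTrajectory {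
    mpc_final_cost : F T = final_cost;
    mpc_init : x 0%N = init_state P;
    mpc_actions : forall s, (s <= t)%N -> mpc_action k F xip s (x s) (u s);
    mpc_dynamics : forall s, (s < t)%N ->
      x s.+1 = dynamics P s (x s) (u s) (true_param P s)
  }.

Definition per_step_error (t : nat) (x : states) (u : actions) (e : R) : Prop :=
  exists y v, clairvoyant_solution t (x t) y v /\ e = enorm (u t - v t).

End ControlProblem.

(* Main.v *)
Require Import Defs.
From mathcomp Require Import all_boot all_order all_algebra.
From mathcomp Require Import all_classical all_reals all_analysis.
From mathcomp Require Import ring.
Import Order.TTheory GRing.Theory Num.Theory.
Import numFieldNormedType.Exports.
Local Open Scope ring_scope.

Set Implicit Arguments.
Unset Strict Implicit.
Unset Printing Implicit Defensive.

(** The controller and the clairvoyant controller solve, from the same state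
    [x t], two problems that differ only in their parameters, so the first part
    of Property (P) bounds the distance between their first actions.

    When the window reaches the horizon this is immediate: the two problems have
    the same terminal cost, the parameters differ by the prediction errors, and
    [||x t|| <= r / C3 + D].

    When [t + k] is before the horizon the windows differ. By the principle of
    optimality, the clairvoyant trajectory [y'] from [x t], cut at time [t + k],
    is optimal for the true parameters and the indicator cost of the state
    [y' (t + k)] (lemma [ftocp_solution_head]). The two problems now have the
    same window and indicator costs with targets [ybar] and [y' (t + k)].
    Property (P) applies provided that [y' (t + k)] lies in the ball of radius
    [r] around [xs (t + k)]. This holds because [xs] is itself clairvoyant from
    time [t] on (lemma [ftocp_solution_tail]), so that the distance is at most
    [q3 k * ||x t - xs t|| <= C3 * (r / C3)]. Both targets are in that ball, at
    distance at most [2 * r] from each other, which gives the additional term of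
    the bound. *)

(** * The Euclidean norm *)

Lemma enorm_ge0 (R : realType) (d : nat) (x : 'rV[R]_d) : 0 <= enorm x.
Proof. exact: sqrtr_ge0. Qed.

Lemma sqr_enorm (R : realType) (d : nat) (x : 'rV[R]_d) :
  enorm x ^+ 2 = \sum_(i < d) x 0 i ^+ 2.
Proof. by rewrite sqr_sqrtr //; apply: sumr_ge0 => i _; apply: sqr_ge0. Qed.

Lemma enormN (R : realType) (d : nat) (x : 'rV[R]_d) : enorm (- x) = enorm x.
Proof.
by congr Num.sqrt; apply: eq_bigr => i _; rewrite mxE sqrrN.
Qed.

Lemma enorm0_eq0 (R : realType) (d : nat) (x : 'rV[R]_d) : enorm x = 0 -> x = 0.
Proof.
move=> x0; apply/rowP => i; rewrite mxE.
have /eqP := sqr_enorm x; rewrite x0 expr0n /= eq_sym psumr_eq0.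
  by move=> /allP /(_ i (mem_index_enum _)) /=; rewrite sqrf_eq0 => /eqP.
by move=> j _; apply: sqr_ge0.
Qed.

(** Cauchy-Schwarz, from the nonnegativity of
    [|| ||y|| x - ||x|| y ||^2 = 2 ||x|| ||y|| (||x|| ||y|| - <x, y>)]. *)
Lemma dot_le_enorm (R : realType) (d : nat) (x y : 'rV[R]_d) :
  \sum_(i < d) x 0 i * y 0 i <= enorm x * enorm y.
Proof.
have [x0|xN0] := eqVneq (enorm x) 0.
  by rewrite x0 mul0r (enorm0_eq0 x0) big1 // => i _; rewrite mxE mul0r.
have [y0|yN0] := eqVneq (enorm y) 0.
  by rewrite y0 mulr0 (enorm0_eq0 y0) big1 // => i _; rewrite mxE mulr0.
have ab_gt0 : 0 < enorm x * enorm y.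
  by rewrite mulr_gt0 // lt0r ?xN0 ?yN0 enorm_ge0.
have : 0 <= \sum_(i < d) (enorm y * x 0 i - enorm x * y 0 i) ^+ 2.
  by apply: sumr_ge0 => i _; apply: sqr_ge0.
have -> : \sum_(i < d) (enorm y * x 0 i - enorm x * y 0 i) ^+ 2
    = 2 * (enorm x * enorm y) * (enorm x * enorm y - \sum_(i < d) x 0 i * y 0 i).
  transitivity (\sum_(i < d) (enorm y ^+ 2 * x 0 i ^+ 2 + enorm x ^+ 2 * y 0 i ^+ 2
      - 2 * (enorm x * enorm y) * (x 0 i * y 0 i))).
    by apply: eq_bigr => i _; ring.
  rewrite sumrB big_split /= -!mulr_sumr -!sqr_enorm; ring.
by rewrite pmulr_rge0 ?subr_ge0 // mulr_gt0.
Qed.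

Lemma ler_enormD (R : realType) (d : nat) (x y : 'rV[R]_d) :
  enorm (x + y) <= enorm x + enorm y.
Proof.
rewrite -(@ler_pXn2r _ 2) ?nnegrE ?addr_ge0 ?enorm_ge0 // sqr_enorm sqrrD !sqr_enorm.
have -> : \sum_(i < d) (x + y) 0 i ^+ 2
    = \sum_(i < d) x 0 i ^+ 2 + (\sum_(i < d) x 0 i * y 0 i) *+ 2
      + \sum_(i < d) y 0 i ^+ 2.
  rewrite -sumrMnl -!big_split /=.
  by apply: eq_bigr => i _; rewrite mxE sqrrD.
by rewrite lerD2r lerD2l lerMn2r dot_le_enorm.
Qed.

(** * Optimal trajectories and the principle of optimality *)

Section Bellman.
Variables (R : realType) (n m : nat) (p c : nat -> nat).
Variable P : control_problem R n m p c.

(** The switch takes place strictly below [s], so that [y'] supplies the state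
    at time [s]; the hypothesis that [y'] starts from [y s] makes the last step
    of the first segment land on it. *)
Lemma ftocp_feasible_glue (t1 s t2 : nat) (z : 'rV[R]_n)
    (xi : forall t, 'rV[R]_(p t)) (y y' : nat -> 'rV[R]_n) (v v' : nat -> 'rV[R]_m) :
  (t1 <= s)%N ->
  ftocp_feasible P t1 s z xi y v ->
  ftocp_feasible P s t2 (y s) xi y' v' ->
  ftocp_feasible P t1 t2 z xi (fun i => if (i < s)%N then y i else y' i)
    (fun i => if (i < s)%N then v i else v' i).
Proof.
move=> t1s [y1 yv] [ys y'v']; split.
  case: ltnP => // st1; have e : t1 = s by apply/eqP; rewrite eqn_leq t1s.
  by rewrite e ys -e.
move=> i /andP[t1i it2]; have [is_|si] := ltnP i s.
  have [|yi ci] := yv i; first by rewrite t1i is_.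
  split; last exact: ci.
  move: is_; rewrite leq_eqVlt => /orP[/eqP e|->]; last by [].
  by rewrite e ltnn ys -e.
rewrite ltnNge (leq_trans si) //=.
by apply: y'v'; rewrite si it2.
Qed.

Lemma ftocp_feasible_sub (t1 s1 s2 t2 : nat) (z : 'rV[R]_n)
    (xi : forall t, 'rV[R]_(p t)) (y : nat -> 'rV[R]_n) (v : nat -> 'rV[R]_m) :
  (t1 <= s1)%N -> (s2 <= t2)%N ->
  ftocp_feasible P t1 t2 z xi y v -> ftocp_feasible P s1 s2 (y s1) xi y v.
Proof.
move=> ts st [_ yv]; split=> // i /andP[si is_].
by apply: yv; rewrite (leq_trans ts si) (leq_trans is_ st).
Qed.

Lemma ftocp_cost_glue (d t1 s t2 : nat) (xi : forall t, 'rV[R]_(p t)) (zeta : 'rV[R]_d)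
    (F : 'rV[R]_n -> 'rV[R]_d -> \bar R)
    (y y' : nat -> 'rV[R]_n) (v v' : nat -> 'rV[R]_m) :
  (t1 <= s <= t2)%N ->
  ftocp_cost P t1 t2 xi zeta F (fun i => if (i < s)%N then y i else y' i)
    (fun i => if (i < s)%N then v i else v' i)
  = ((\sum_(t1 <= i < s) stage_cost P i (y i) (v i) (xi i))%:E
     + ftocp_cost P s t2 xi zeta F y' v')%E.
Proof.
move=> /andP[t1s st2]; rewrite /ftocp_cost ltnNge st2 /= addeA -EFinD.
rewrite (big_cat_nat t1s st2) /=; congr ((_ + _)%:E + _)%E.
  by apply: eq_big_nat => i /andP[_ ->].
by apply: eq_big_nat => i /andP[si _]; rewrite ltnNge si.
Qed.

Lemma ftocp_cost_split (d t1 s t2 : nat) (xi : forall t, 'rV[R]_(p t)) (zeta : 'rV[R]_d)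
    (F : 'rV[R]_n -> 'rV[R]_d -> \bar R) (y : nat -> 'rV[R]_n) (v : nat -> 'rV[R]_m) :
  (t1 <= s <= t2)%N ->
  ftocp_cost P t1 t2 xi zeta F y v
  = ((\sum_(t1 <= i < s) stage_cost P i (y i) (v i) (xi i))%:E
     + ftocp_cost P s t2 xi zeta F y v)%E.
Proof.
by move=> /andP[t1s st2]; rewrite /ftocp_cost addeA -EFinD (big_cat_nat t1s st2).
Qed.

(** Bellman's principle: a cheaper continuation from [y s], glued after the
    first steps of [y], would beat [y] on the whole window. The cost of these
    first steps is a real number, so it cancels. *)
Lemma ftocp_solution_tail (d t1 s t2 : nat) (z : 'rV[R]_n)
    (xi : forall t, 'rV[R]_(p t)) (zeta : 'rV[R]_d)
    (F : 'rV[R]_n -> 'rV[R]_d -> \bar R) (y : nat -> 'rV[R]_n) (v : nat -> 'rV[R]_m) :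
  (t1 <= s <= t2)%N ->
  ftocp_solution P t1 t2 z xi zeta F y v ->
  ftocp_solution P s t2 (y s) xi zeta F y v.
Proof.
move=> t1st2; have /andP[t1s st2] := t1st2 => -[yv fin opt]; split.
- exact: ftocp_feasible_sub yv.
- move: fin; rewrite (ftocp_cost_split _ _ _ _ _ t1st2).
  by case: (ftocp_cost P s _ _ _ _ _ _) => [a||] //=; rewrite ?ltry.
- move=> y' v' y'v'.
  have yvs : ftocp_feasible P t1 s z xi y v.
    by case: (yv) => yz _; rewrite -yz; apply: ftocp_feasible_sub yv.
  have := opt _ _ (ftocp_feasible_glue t1s yvs y'v').
  by rewrite ftocp_cost_glue // (ftocp_cost_split _ _ _ _ _ t1st2) leeD2lE.
Qed.

(** The initial segment of an optimal trajectory is optimal among those that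
    reach the same state [y s]: the remaining steps of the trajectory can be
    glued after any competitor. Finiteness of the terminal cost is what allows
    the cost of these remaining steps to be cancelled. *)
Lemma ftocp_solution_head (d t1 s t2 : nat) (z : 'rV[R]_n)
    (xi : forall t, 'rV[R]_(p t)) (zeta : 'rV[R]_d)
    (F : 'rV[R]_n -> 'rV[R]_d -> \bar R) (y : nat -> 'rV[R]_n) (v : nat -> 'rV[R]_m) :
  (t1 <= s <= t2)%N -> F (y t2) zeta \is a fin_num ->
  ftocp_solution P t1 t2 z xi zeta F y v ->
  ftocp_solution P t1 s z xi (y s) (@indicator_cost R n) y v.
Proof.
move=> t1st2 Ffin; have /andP[t1s st2] := t1st2 => -[yv _ opt]; split.
- by case: (yv) => yz _; rewrite -yz; apply: ftocp_feasible_sub yv.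
- by rewrite /ftocp_cost /indicator_cost eqxx adde0 ltry.
- move=> y' v' y'v'; rewrite {2}/ftocp_cost /indicator_cost.
  case: eqP => [ys|_]; last by rewrite addey // leey.
  have yvs : ftocp_feasible P s t2 (y' s) xi y v.
    by rewrite ys; apply: ftocp_feasible_sub yv.
  have := opt _ _ (ftocp_feasible_glue t1s y'v' yvs).
  rewrite ftocp_cost_glue // (ftocp_cost_split _ _ _ _ _ t1st2) leeD2rE.
    by rewrite /ftocp_cost /indicator_cost eqxx !adde0.
  by rewrite /ftocp_cost fin_numD Ffin.
Qed.

(** A terminal cost family matters only through its value at the terminal
    parameter. A controller whose terminal parameter is a predicted one thus
    solves the problem with an indicator cost whose parameter is a state; the
    two parameters may have different dimensions. *)
Lemma ftocp_solution_eq_terminal (d d' t1 t2 : nat) (z : 'rV[R]_n)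
    (xi : forall t, 'rV[R]_(p t)) (zeta : 'rV[R]_d) (zeta' : 'rV[R]_d')
    (F : 'rV[R]_n -> 'rV[R]_d -> \bar R) (F' : 'rV[R]_n -> 'rV[R]_d' -> \bar R)
    (y : nat -> 'rV[R]_n) (v : nat -> 'rV[R]_m) :
  (forall w, F w zeta = F' w zeta') ->
  ftocp_solution P t1 t2 z xi zeta F y v -> ftocp_solution P t1 t2 z xi zeta' F' y v.
Proof.
move=> FF'.
have costE y0 v0 : ftocp_cost P t1 t2 xi zeta F y0 v0 = ftocp_cost P t1 t2 xi zeta' F' y0 v0.
  by rewrite /ftocp_cost FF'.
by move=> [yv fin opt]; split=> // [|y' v' yv']; rewrite -!costE //; apply: opt.
Qed.

(** On a ball of states the two sums of a perturbation bound merge into one,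
    with weight [B * q1 + q2]. The terminal term is kept apart because its
    parameters may be states instead of stage parameters. *)
Lemma perturbation_bound_weighted (q1 q2 : nat -> R) (d t1 t2 : nat) (z : 'rV[R]_n)
    (xi xi' : forall t, 'rV[R]_(p t)) (zeta zeta' : 'rV[R]_d)
    (F : 'rV[R]_n -> 'rV[R]_d -> \bar R)
    (y y' : nat -> 'rV[R]_n) (v v' : nat -> 'rV[R]_m) (B : R) :
  (t1 <= t2)%N -> (forall i, 0 <= q1 i) -> enorm z <= B ->
  perturbation_bound P q1 q2 t1 t2 z xi xi' zeta zeta' F ->
  ftocp_solution P t1 t2 z xi zeta F y v ->
  ftocp_solution P t1 t2 z xi' zeta' F y' v' ->
  enorm (v t1 - v' t1) <=
    \sum_(0 <= tau < t2 - t1)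
       (B * q1 tau + q2 tau) * enorm (xi (t1 + tau)%N - xi' (t1 + tau)%N)
    + (B * q1 (t2 - t1)%N + q2 (t2 - t1)%N) * enorm (zeta - zeta').
Proof.
move=> t12 q1_ge0 zB pb sol sol'.
pose dl i := if (i < t2)%N then enorm (xi i - xi' i) else enorm (zeta - zeta').
have : enorm (v t1 - v' t1) <=
    (\sum_(t1 <= i < t2.+1) q1 (i - t1)%N * dl i) * enorm z
    + \sum_(t1 <= i < t2.+1) q2 (i - t1)%N * dl i := pb _ _ _ _ sol sol'.
move=> /le_trans; apply.
have dl_ge0 i : 0 <= dl i by rewrite /dl; case: ifP => _; apply: enorm_ge0.
apply: (@le_trans _ _ (\sum_(t1 <= i < t2.+1) (B * q1 (i - t1)%N + q2 (i - t1)%N) * dl i)).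
  rewrite mulr_suml -big_split /=; apply: ler_sum => i _.
  rewrite mulrDl lerD2r mulrC mulrA.
  by rewrite ler_wpM2r // ler_wpM2r.
rewrite -{1}(add0n t1) big_addn subSn // big_nat_recr //= addnK subnK //.
rewrite {2}/dl ltnn lerD2r.
apply: ler_sum_nat => i /andP[_ it]; rewrite addnK addnC /dl.
by rewrite -ltn_subRL it.
Qed.

End Bellman.

(** The summability condition of Property (P) is used through this pointwise
    bound, which keeps clairvoyant trajectories in the balls where the
    perturbation bounds apply. *)
Lemma nneseries_term_le (R : realType) (q : nat -> R) (C : R) (i : nat) :
  (forall j, 0 <= q j) ->
  (\big[+%E/0%E]_(0 <= j <oo) (q j)%:E <= C%:E)%E -> q i <= C.
Proof.
move=> q_ge0 qC; rewrite -lee_fin; apply: le_trans qC.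
apply: le_trans (@nneseries_lim_ge R (fun j => (q j)%:E) xpredT 0%N i.+1 _);
  last by move=> j _ _; rewrite lee_fin.
rewrite big_nat_recr //= leeDr // sume_ge0 // => j _.
by rewrite lee_fin.
Qed.

(** * The per-step error bound *)

Unset Implicit Arguments.

Theorem lemma3p1 (R : realType) (n m : nat) (p c : nat -> nat)
    (P : control_problem R n m p c)
    (xs : nat -> 'rV[R]_n) (us : nat -> 'rV[R]_m) (D Lg l : R)
    (k : nat) (xip : nat -> forall tau, 'rV[R]_(p tau))
    (r : R) (q1 q2 q3 : nat -> R) (C1 C2 C3 : R)
    (F : forall tau, 'rV[R]_n -> 'rV[R]_(p tau) -> \bar R)
    (t : nat) (x : nat -> 'rV[R]_n) (u : nat -> 'rV[R]_m)
    (ybar : 'rV[R]_(p (t + k)%N) -> 'rV[R]_n) (e : R) :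
  admissible_params P ->
  optimal_trajectory P xs us ->
  standing_assumptions P xs D Lg l ->
  (1 <= k <= horizon P)%N ->
  admissible_predictions P k xip ->
  property_P P k xs r q1 q2 q3 C1 C2 C3 ->
  (t < horizon P)%N ->
  mpc_trajectory P k F xip t x u ->
  eball (xs t) (r / C3) (x t) ->
  ((t < horizon P - k)%N ->
     (forall y, F (t + k)%N y (xip t (t + k)%N)
        = indicator_cost y (ybar (xip t (t + k)%N))) /\
     eball (xs (t + k)%N) r (ybar (xip t (t + k)%N))) ->
  per_step_error P t x u e ->
  e <= \sum_(0 <= tau < k.+1)
         ((r / C3 + D) * q1 tau + q2 tau) * prediction_error P xip t tau
       + 2 * r * ((r / C3 + D) * q1 k + q2 k).
Proof.
move=> _ opt std /andP[k_gt0 kT] adm [r_gt0 q_ge0 _ _ [_ _ C3_ge1] _ _ q3C pind pfin pst].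
move=> tT mpc xt_ball Fbar [y' [v' [sol' ->]]].
have C3_gt0 : 0 < C3 by apply: lt_le_trans C3_ge1.
have q1_ge0 i : 0 <= q1 i by case: (q_ge0 i).
have q2_ge0 i : 0 <= q2 i by case: (q_ge0 i).
have q3_ge0 i : 0 <= q3 i by case: (q_ge0 i).
have rC3 : r / C3 <= r by rewrite ler_pdivrMr // ler_peMr // ltW.
have xt_ball' : eball (xs t) r (x t) by rewrite /eball /=; apply: le_trans rC3.
have D_ge0 : 0 <= D.
  by apply: le_trans (opt_bounded std _); [apply: enorm_ge0|apply: leq0n].
have xtB : enorm (x t) <= r / C3 + D.
  rewrite -[x t](subrK (xs t)); apply: le_trans (ler_enormD _ _) _.
  by apply: lerD => //; apply: (opt_bounded std); apply: ltnW.
have B_ge0 : 0 <= r / C3 + D by rewrite addr_ge0 // divr_ge0 // ltW.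
set w := fun i => (r / C3 + D) * q1 i + q2 i.
have w_ge0 i : 0 <= w i by rewrite addr_ge0 // mulr_ge0.
have rho_ge0 i : 0 <= prediction_error P xip t i.
  by rewrite /prediction_error; case: ifP => _ //; apply: enorm_ge0.
case: (mpc) => FT _ /(_ _ (leqnn t)) [y [v [+ ut]]] _; rewrite ut.
have [tk|Tk] := ltnP t (horizon P - k).
  have tkT : (t + k < horizon P)%N by rewrite addnC -ltn_subRL.
  have [Feq ybar_ball] := Fbar tk.
  rewrite (minn_idPl (ltnW tkT)) => /(ftocp_solution_eq_terminal Feq) sol.
  have sol'k : ftocp_solution P t (t + k) (x t) (true_param P) (y' (t + k)%N)
      (@indicator_cost R n) y' v'.
    by apply: ftocp_solution_head sol'; rewrite // leq_addr ltnW.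
  (* A tail of the optimal trajectory is clairvoyant too, so [y'] can be compared
     with it: the distance between them, at most [r / C3] at time [t], is
     multiplied by at most [q3 k <= C3] at time [t + k]. *)
  have y'_ball : enorm (y' (t + k)%N - xs (t + k)%N) <= r.
    have xs_sol : clairvoyant_solution P t (xs t) xs us.
      by apply: ftocp_solution_tail opt; rewrite /= ltnW.
    have xs_ball : eball (xs t) r (xs t).
      rewrite /eball /= subrr /enorm big1 ?sqrtr0 ?ltW // => i _.
      by rewrite mxE expr0n.
    have [+ _] := pst t tT _ _ xt_ball' xs_ball _ _ _ _ sol' xs_sol.
    move=> /(_ (t + k)%N); rewrite leq_addr ltnW // addKn => /(_ isT) /le_trans; apply.
    rewrite -(divfK (lt0r_neq0 C3_gt0) r) mulrC.
    apply: ler_pM => //; first exact: enorm_ge0.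
    exact: nneseries_term_le q3C.
  have gap : enorm (ybar (xip t (t + k)%N) - y' (t + k)%N) <= 2 * r.
    rewrite -(subrKA (xs (t + k)%N)) mulr_natl mulr2n.
    apply: le_trans (ler_enormD _ _) _; apply: lerD => //.
    by rewrite -enormN opprB.
  have pb := pind t tk _ (xip t) _ _ xt_ball' _ ybar_ball y'_ball.
  apply: le_trans (perturbation_bound_weighted _ q1_ge0 xtB (pb _) sol sol'k) _.
  - exact: leq_addr.
  - move=> tau /andP[t_tau tau_k]; apply: adm => //.
    by rewrite t_tau leq_min (ltnW tau_k) (ltnW (ltn_trans tau_k tkT)).
  rewrite addKn big_nat_recr //= -addrA; apply: lerD.
    apply: ler_sum_nat => i /andP[_ ik].
    by rewrite /prediction_error (leq_trans _ (ltnW tkT)) // leq_add2l ltnW.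
  apply: ler_wpDl; first exact: mulr_ge0 (w_ge0 _) (rho_ge0 _).
  by rewrite [leRHS]mulrC; apply: ler_wpM2l (w_ge0 _) _ _ gap.
have Ttk : (horizon P <= t + k)%N by rewrite addnC -leq_subLR.
rewrite (minn_idPr Ttk) FT => sol.
have pb : perturbation_bound P q1 q2 t (horizon P) (x t) (xip t) (true_param P)
    (xip t (horizon P)) (true_param P (horizon P)) (@final_cost _ _ _ _ _ P).
  apply: pfin => //; first by rewrite Tk.
  by move=> tau tauT; apply: adm => //; rewrite (minn_idPr Ttk).
apply: le_trans (perturbation_bound_weighted (ltnW tT) q1_ge0 xtB pb sol sol') _.
apply: ler_wpDr; first by rewrite mulr_ge0 ?(w_ge0 k) // mulr_ge0 // ltW.
have Tt : (horizon P - t <= k)%N by rewrite leq_subLR.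
(* The window stops at the horizon, possibly before [k] steps; the terms
   beyond it are nonnegative. *)
rewrite [leRHS](@big_cat_nat _ _ _ (horizon P - t).+1) //=.
apply: ler_wpDr; first by apply: sumr_ge0 => i _; apply: mulr_ge0 (w_ge0 _) (rho_ge0 _).
rewrite big_nat_recr //= /prediction_error subnKC ?(ltnW tT) // leqnn lerD2r.
apply: ler_sum_nat => i /andP[_ iT].
by rewrite (ltnW (_ : t + i < horizon P)%N) // -ltn_subRL.
Qed.
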